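(* Let $(P,\preceq)$ be a connected naturally labeled poset. Then $$h^*(\mathcal{L}(P),z) \;=\; \mathcal{G}_{\mathrm{Ldes}}(P,z) \;:=\; \sum_{\tau \in \mathrm{DC}(P)} z^{\mathrm{Ldes}_P(\tau)} .$$
   Context: All posets are finite. For a poset $(P,\preceq)$, $a \lessdot b$ denotes a cover relation, and $\check{P} = P \cup \{\hat 0\}$ is $P$ with a new minimum $\hat 0$ adjoined. A poset is connected if its Hasse diagram is connected. Lipschitz polytope: $\mathcal{L}(P) \subset \mathbb{R}^P$ is the set of all $f : P \to \mathbb{R}$ with $0 \le f(a) \le 1$ for every minimal element $a$ of $P$ and $0 \le f(b)-f(a) \le 1$ for every cover relation $a \lessdot b$ in $P$. It is a full-dimensional lattice polytope with respect to $\mathbb{Z}^P$. $P$ is naturally labeled if its ground set is $\{1,\dots,n\}$, $n = |P|$, and $a \prec b$ implies $a < b$ as integers; one sets $\hat 0 := 0$. For $\tau \in \mathfrak{S}_n$ set $\tau(0) := 0$. For a saturated chain $C = \{\hat 0 = c_1 \lessdot \cdots \lessdot c_k = a\}$ in $\check{P}$ let $\mathrm{des}(\tau|_C)$ be the number of $1 \le j < k$ with $\tau(c_j) > \tau(c_{j+1})$. The permutation $\tau$ is descent-compatible with $P$ if for every $a \in P$ the number $\mathrm{des}(\tau|_C)$ is the same for all saturated chains $C$ in $\check{P}$ from $\hat 0$ to $a$; then $\mathrm{des}_{P,\tau}(a)$ denotes this common number, and $\mathrm{des}_{P,\tau}(\hat 0) := 0$. $\mathrm{DC}(P) \subseteq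 \mathfrak{S}_n$ is the set of descent-compatible permutations. For $\tau \in \mathrm{DC}(P)$, $\mathrm{Ldes}_P(\tau)$ is the number of pairs $(a,b) \in \check{P} \times \check{P}$ with $\tau(a) = \tau(b) - 1$ such that either $\mathrm{des}_{P,\tau}(a) < \mathrm{des}_{P,\tau}(b)$, or $\mathrm{des}_{P,\tau}(a) = \mathrm{des}_{P,\tau}(b)$ and $a > b$ (as integers). For a full-dimensional lattice polytope $\mathcal{P} \subset \mathbb{R}^n$, the $h^*$-polynomial is $h^*(\mathcal{P},z) = (1-z)^{n+1} \sum_{k \ge 0} |k\mathcal{P} \cap \mathbb{Z}^n| \, z^k$. *)

(* Defs.v *)
From mathcomp Require Import all_boot all_order all_fingroup all_algebra.
From mathcomp Require Import finmap.
From mathcomp Require Import boolp classical_sets cardinality reals.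

Set Implicit Arguments.
Unset Strict Implicit.
Unset Printing Implicit Defensive.

Import Order.TTheory GRing.Theory Num.Theory.
Local Open Scope classical_set_scope.
Local Open Scope ring_scope.

Section Posets.
Variables (T : finType) (le : rel T).

Definition is_poset := [/\ reflexive le, antisymmetric le & transitive le].

Definition covers : rel T := fun a b =>
  [&& le a b, a != b & [forall c, le a c && le c b ==> (c == a) || (c == b)]].

Definition minimal_elt (a : T) := [forall b, le b a ==> (b == a)].

Definition connected_poset :=
  forall a b : T, connect (fun x y => covers x y || covers y x) a b.

End Posets.

(* A poset on {1, ..., n} is a relation on 'I_n, where i : 'I_n stands for the
   label i + 1.  Since this shift preserves the order of the integers,
   comparing labels is comparing the values of the ordinals. *)
Definition naturally_labeled n (le : rel 'I_n) :=
  forall a b : 'I_n, le a b -> a != b -> (a < b)%N.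

(* P with a minimum adjoined lives on {0, ..., n}: ord0 is the new minimum and
   lift ord0 i, whose value is i + 1, is the element i : 'I_n of P. *)
Definition check_le n (le : rel 'I_n) : rel 'I_n.+1 := fun x y =>
  match unlift ord0 x, unlift ord0 y with
  | None, _ => true
  | Some _, None => false
  | Some a, Some b => le a b
  end.

Definition lipschitz_polytope (R : realType) n (le : rel 'I_n) :
    set 'rV[R]_n :=
  [set f | (forall a, minimal_elt le a -> 0 <= f 0 a <= 1) /\
           (forall a b, covers le a b -> 0 <= f 0 b - f 0 a <= 1)].
Arguments lipschitz_polytope R {n} le.

Section DescentCompatible.
Variables (n : nat) (le : rel 'I_n).

(* tau extended to {0, ..., n} by tau(0) = 0; in terms of the labels
   1, ..., n, it maps i + 1 to tau i + 1. *)
Definition ext_perm (tau : 'S_n) : 'S_n.+1 := lift_perm ord0 ord0 tau.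

(* The chain is ord0 :: s. *)
Definition saturated_chain (a : 'I_n.+1) (s : seq 'I_n.+1) :=
  path (covers (check_le le)) ord0 s /\ last ord0 s = a.

Definition des_chain (tau : 'S_n) (s : seq 'I_n.+1) : nat :=
  count id (pairmap (fun x y => (ext_perm tau y < ext_perm tau x)%N) ord0 s).

Definition descent_compatible (tau : 'S_n) : Prop :=
  forall (a : 'I_n) (s1 s2 : seq 'I_n.+1),
    saturated_chain (lift ord0 a) s1 -> saturated_chain (lift ord0 a) s2 ->
    des_chain tau s1 = des_chain tau s2.

Definition DC : {set 'S_n} := [set tau | `[< descent_compatible tau >] ]%SET.

(* The only saturated chain from ord0 to ord0 is the trivial one, so that
   des_at tau ord0 = 0.  The default value 0 of xget is never used when le is a
   partial order, as every element then ends some saturated chain. *)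
Definition des_at (tau : 'S_n) (a : 'I_n.+1) : nat :=
  xget 0%N [set d | exists2 s, saturated_chain a s & des_chain tau s = d].

Definition Ldes (tau : 'S_n) : nat :=
  #|[set p : 'I_n.+1 * 'I_n.+1 |
      ((ext_perm tau p.1).+1 == ext_perm tau p.2 :> nat) &&
      ((des_at tau p.1 < des_at tau p.2)%N ||
       (des_at tau p.1 == des_at tau p.2) && (p.2 < p.1)%N)]%SET|.

Definition G_Ldes : {poly int} := \sum_(tau in DC) 'X^(Ldes tau).

End DescentCompatible.

(* Formal power series over the integers, as sequences of coefficients. *)
Definition series_mul (u v : nat -> int) : nat -> int :=
  fun i => \sum_(j < i.+1) u j * v (i - j)%N.

Definition series_of_poly (p : {poly int}) : nat -> int := fun i => p`_i.

Section HStar.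
Variables (R : realType) (n : nat).

Definition lattice : set 'rV[R]_n := [set x | forall i, x 0 i \is a Num.int].

Definition dilate (k : nat) (A : set 'rV[R]_n) : set 'rV[R]_n :=
  [set k%:R *: x | x in A].

(* Meaningful for bounded A; fset_set of an infinite set is empty. *)
Definition lattice_count (A : set 'rV[R]_n) (k : nat) : nat :=
  #|` fset_set (dilate k A `&` lattice)|.

Definition hstar (A : set 'rV[R]_n) : nat -> int :=
  series_mul (series_of_poly ((1 - 'X) ^+ n.+1))
             (fun k => (lattice_count A k)%:Z).

End HStar.

(* Main.v *)
(* An integer point of the k-th dilate of the Lipschitz polytope is a function g
   on the poset with minimum adjoined, vanishing at the minimum, with
   0 <= g y - g x <= k along covers x < y.  Write g = k D + r with 0 <= r <= k,
   taking r = k rather than r = 0 whenever there is a choice.  Let tau sort the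
   elements by increasing r, then decreasing D, then increasing label.  The
   cover inequalities, together with natural labeling, say exactly that D
   increases along a cover by 0 or 1 according to whether tau ascends or
   descends there, so tau is descent-compatible and D is its descent function.
   The ties allowed in r along tau are those between consecutive elements not
   counted by Ldes.  Hence the points with given tau are the sequences
   0 = s_0 <= ... <= s_n <= k with Ldes tau prescribed strict steps, of which
   there are 'C(n + k - Ldes tau, n), with generating function
   z^(Ldes tau) / (1 - z)^(n+1). *)
Require Import Defs.
From mathcomp Require Import all_boot all_order all_fingroup all_algebra.
From mathcomp Require Import finmap zify.
From mathcomp Require Import boolp classical_sets cardinality reals.

Set Implicit Arguments.
Unset Strict Implicit.
Unset Printing Implicit Defensive.

Import Order.TTheory GRing.Theory Num.Theory.

(** * Covers and saturated chains after adjoining a minimum *)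

Lemma ord_lift0_ind n (Q : 'I_n.+1 -> Prop) :
  Q ord0 -> (forall i, Q (lift ord0 i)) -> forall x, Q x.
Proof. by move=> Q0 Ql x; case: (unliftP ord0 x) => [j|] ->. Qed.

Section Adjoin.
Variables (n : nat) (le : rel 'I_n).

Lemma check_le0x x : check_le le ord0 x.
Proof. by rewrite /check_le unlift_none. Qed.

Lemma check_lex0 x : check_le le x ord0 = (x == ord0).
Proof.
by elim/ord_lift0_ind: x => [|a]; rewrite /check_le ?liftK unlift_none.
Qed.

Lemma check_le_lift0 a : check_le le (lift ord0 a) ord0 = false.
Proof. by rewrite check_lex0. Qed.

Lemma check_le_lift a b : check_le le (lift ord0 a) (lift ord0 b) = le a b.
Proof. by rewrite /check_le !liftK. Qed.

Lemma check_covers_lift a b :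
  covers (check_le le) (lift ord0 a) (lift ord0 b) = covers le a b.
Proof.
rewrite /covers check_le_lift (inj_eq lift_inj); do 2!congr andb.
apply/forallP/forallP => H c.
  by have := H (lift ord0 c); rewrite !check_le_lift !(inj_eq lift_inj).
elim/ord_lift0_ind: c => [|c]; first by rewrite check_le_lift0.
by rewrite !check_le_lift !(inj_eq lift_inj).
Qed.

Lemma check_covers_x0 x : covers (check_le le) x ord0 = false.
Proof. by rewrite /covers check_lex0; case: eqP. Qed.

Lemma check_covers_0lift a :
  covers (check_le le) ord0 (lift ord0 a) = minimal_elt le a.
Proof.
rewrite /covers check_le0x neq_lift /=.
apply/forallP/forallP => H c.
  have := H (lift ord0 c).
  rewrite check_le0x check_le_lift !(inj_eq lift_inj) (eq_sym _ ord0).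
  by rewrite (negbTE (neq_lift _ _)).
elim/ord_lift0_ind: c => [|c]; first by rewrite eqxx /= implybT.
rewrite check_le0x check_le_lift !(inj_eq lift_inj) (eq_sym _ ord0).
by rewrite (negbTE (neq_lift _ _)); apply: H.
Qed.

Hypothesis le_poset : is_poset le.
Hypothesis le_natural : naturally_labeled le.

Lemma check_le_poset : is_poset (check_le le).
Proof.
have [refl asym trans] := le_poset; split.
- by elim/ord_lift0_ind => [|a]; rewrite ?check_le0x ?check_le_lift.
- elim/ord_lift0_ind => [|a]; elim/ord_lift0_ind => [|b].
  + by [].
  + by rewrite check_le_lift0 andbF.
  + by rewrite check_le_lift0.
  + by rewrite !check_le_lift => /asym ->.
- move=> y x z; elim/ord_lift0_ind: x => [|a]; first by rewrite !check_le0x.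
  elim/ord_lift0_ind: y => [|b]; first by rewrite check_le_lift0.
  elim/ord_lift0_ind: z => [|c]; first by rewrite check_le_lift0.
  by rewrite !check_le_lift => /trans; apply.
Qed.

Lemma check_le_natural : naturally_labeled (check_le le).
Proof.
move=> x y; elim/ord_lift0_ind: y => [|b].
  by rewrite check_lex0 => /eqP ->; rewrite eqxx.
elim/ord_lift0_ind: x => [//|a].
by rewrite check_le_lift (inj_eq lift_inj) !lift0 ltnS; apply: le_natural.
Qed.

Lemma check_covers_lt x y : covers (check_le le) x y -> x < y.
Proof. by case/and3P=> lexy nexy _; apply: check_le_natural. Qed.

(* Take an element of largest label strictly below [lift ord0 a]. *)
Lemma exists_lower_cover a :
  exists x, covers (check_le le) x (lift ord0 a).
Proof.
have [_ _ trans] := check_le_poset.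
set y := lift ord0 a.
have P0 : check_le le ord0 y && (ord0 != y) by rewrite check_le0x neq_lift.
case: (@arg_maxnP _ ord0 (fun x => check_le le x y && (x != y)) val P0) => x.
move=> /andP[lexy nexy] xmax; exists x; rewrite /covers lexy nexy /=.
apply/forallP => c; apply/implyP => /andP[lexc lecy].
case: (eqVneq c y) => [|ncy] //=; first by rewrite orbT.
rewrite orbF; apply: contraT => ncx.
have := xmax c; rewrite lecy ncy => /(_ isT).
by have := check_le_natural lexc; rewrite eq_sym ncx => /(_ isT) /=; lia.
Qed.

(** Strong induction on the label: a nonzero element has a lower cover, whose label is smaller by
    natural labeling. *)
Lemma cover_ind (Q : 'I_n.+1 -> Prop) :
    Q ord0 -> (forall x y, covers (check_le le) x y -> Q x -> Q y) ->
  forall x, Q x.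
Proof.
move=> Q0 Qc x; have [m] := ubnP (val x); elim: m x => // m IH x.
elim/ord_lift0_ind: x => [//|a] lt_am.
have [x xa] := exists_lower_cover a; apply: Qc (xa) (IH _ _).
by have := check_covers_lt xa; move: lt_am; rewrite /=; lia.
Qed.

Lemma exists_chain x : exists s, saturated_chain le x s.
Proof.
elim/cover_ind: x => [|x y xy [s [ps ls]]]; first by exists [::].
by exists (rcons s y); split; rewrite ?last_rcons // rcons_path ps ls.
Qed.

Lemma chain_to0 s : saturated_chain le ord0 s -> s = [::].
Proof.
case/lastP: s => // s z [+ +]; rewrite last_rcons rcons_path => /andP[_ +] z0.
by rewrite z0 check_covers_x0.
Qed.

(** * Descent functions along covers *)

Section DescentFunction.
Variable tau : 'S_n.

Lemma des_at0 : des_at le tau ord0 = 0.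
Proof.
rewrite /des_at; case: xgetP => // d _ [s hs <-].
by rewrite (chain_to0 hs).
Qed.

Lemma des_at_chain x s : tau \in DC le -> saturated_chain le x s ->
  des_at le tau x = des_chain tau s.
Proof.
rewrite inE => /asboolP dc; elim/ord_lift0_ind: x => [|a] hs.
  by rewrite des_at0 (chain_to0 hs).
rewrite /des_at; case: xgetP => [d _ [s' hs' <-]|/(_ (des_chain tau s)) []].
  exact: dc hs' hs.
by exists s.
Qed.

Lemma des_chain_rcons s y :
  des_chain tau (rcons s y) =
  des_chain tau s + (ext_perm tau y < ext_perm tau (last ord0 s)).
Proof.
rewrite /des_chain -cats1 pairmap_cat count_cat /=.
by rewrite addn0.
Qed.

Lemma des_at_cover x y : tau \in DC le -> covers (check_le le) x y ->
  des_at le tau y = des_at le tau x + (ext_perm tau y < ext_perm tau x).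
Proof.
move=> dc xy; have [s [ps ls]] := exists_chain x.
have hs' : saturated_chain le y (rcons s y).
  by split; rewrite ?last_rcons // rcons_path ps ls.
by rewrite (des_at_chain dc hs') des_chain_rcons ls (des_at_chain dc (conj ps ls)).
Qed.

(** The increments of [D] telescope along a chain from the minimum, so every chain to [x] has [D x]
    descents. This yields descent-compatibility from conditions on single covers. *)
Lemma descent_potential (D : 'I_n.+1 -> nat) :
    D ord0 = 0 ->
    (forall x y, covers (check_le le) x y ->
       D y = D x + (ext_perm tau y < ext_perm tau x)) ->
  tau \in DC le /\ des_at le tau =1 D.
Proof.
move=> D0 Dc.
have DE s x : saturated_chain le x s -> des_chain tau s = D x.
  elim/last_ind: s x => [|s y IH] x [+ <-] //; rewrite last_rcons.
  rewrite rcons_path => /andP[ps py].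
  by rewrite des_chain_rcons (IH _ (conj ps erefl)) (Dc _ _ py).
have dc : tau \in DC le.
  by rewrite inE; apply/asboolP => a s1 s2 /DE -> /DE ->.
split=> // x; have [s hs] := exists_chain x.
by rewrite (des_at_chain dc hs) (DE _ _ hs).
Qed.

End DescentFunction.
End Adjoin.

(** * Permutations as linear orders *)

Lemma ext_perm0 n (tau : 'S_n) : ext_perm tau ord0 = ord0.
Proof. exact: lift_perm_id. Qed.

Lemma ext_perm_lift n (tau : 'S_n) i :
  ext_perm tau (lift ord0 i) = lift ord0 (tau i).
Proof. exact: lift_perm_lift. Qed.

Lemma perm_rank n (s : 'S_n) x : val (s x) = #|[set y | s y < s x]|.
Proof.
have -> : [set y | s y < s x] = s @^-1: [set z : 'I_n | z < s x].
  by apply/setP => y; rewrite !inE.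
rewrite card_preimset; last exact: perm_inj.
have -> : [set z : 'I_n | z < s x] =
    [set widen_ord (ltnW (ltn_ord (s x))) i | i : 'I_(s x)].
  apply/setP => z; rewrite !inE; apply/idP/imsetP => [lt|[i _ ->]]; last first.
    exact: (ltn_ord i).
  by exists (Ordinal lt) => //; apply: val_inj.
rewrite card_imset ?card_ord // => i j /(congr1 val) /= ij; exact: val_inj.
Qed.

Lemma ext_perm_order_inj n (s t : 'S_n) :
    (forall x y, (ext_perm s x < ext_perm s y) = (ext_perm t x < ext_perm t y)) ->
  s = t.
Proof.
move=> H; apply/permP => i; apply: (@lift_inj _ ord0); apply: val_inj.
rewrite -!ext_perm_lift (perm_rank (ext_perm s)) (perm_rank (ext_perm t)).
by apply: eq_card => y; rewrite !inE H.
Qed.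

(** The permutation sends an element to its rank among the nonzero elements. Since [ord0] comes
    first, prolonging by 0 at 0 agrees with the order on all of ['I_n.+1]. *)
Lemma exists_ext_perm n (lt : rel 'I_n.+1) :
    irreflexive lt -> transitive lt ->
    (forall x y, x != y -> lt x y || lt y x) ->
    (forall i, lt ord0 (lift ord0 i)) ->
  exists tau : 'S_n, forall x y, (ext_perm tau x < ext_perm tau y) = lt x y.
Proof.
move=> irr tr tot lt0.
pose A (j : 'I_n) := [set i | lt (lift ord0 i) (lift ord0 j)].
have rkP j : #|A j| < n.
  rewrite -[X in _ < X]card_ord -cardsT; apply: proper_card.
  by rewrite properT; apply/eqP => /setP/(_ j); rewrite !inE irr.
have rk_lt i j : lt (lift ord0 i) (lift ord0 j) -> #|A i| < #|A j|.
  move=> ij; apply: proper_card; apply/properP; split.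
    by apply/fintype.subsetP => l; rewrite !inE => /tr; apply.
  by exists i; rewrite !inE ?irr.
pose f j := Ordinal (rkP j).
have lt_total i j :
    i != j -> lt (lift ord0 i) (lift ord0 j) || lt (lift ord0 j) (lift ord0 i).
  by move=> ij; apply: tot; rewrite (inj_eq lift_inj).
have finj : injective f.
  move=> i j /(congr1 val) /= ij; apply/eqP; apply: contraT => /lt_total.
  by case/orP => /rk_lt; rewrite ij ltnn.
exists (perm finj) => x y.
elim/ord_lift0_ind: x => [|i]; elim/ord_lift0_ind: y => [|j].
- by rewrite irr ltnn.
- by rewrite lt0 ext_perm0 ext_perm_lift.
- rewrite ext_perm0 ltn0; apply/esym/negbTE/negP => h.
  by have := tr _ _ _ h (lt0 i); rewrite irr.
- rewrite !ext_perm_lift !lift0 ltnS !permE /=.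
  apply/idP/idP => [|/rk_lt //]; case: (eqVneq i j) => [->|/lt_total].
    by rewrite ltnn.
  by case/orP => [-> //|/rk_lt ji ij]; have := ltn_trans ji ij; rewrite ltnn.
Qed.

(** * Counting sequences with prescribed gaps *)

Section GappedSequences.
Variables (n : nat) (e : 'I_n -> nat).

Definition gapped k : {set {ffun 'I_n.+1 -> 'I_k.+1}} :=
  [set s : {ffun 'I_n.+1 -> 'I_k.+1} | (s ord0 == ord0) &&
    [forall i : 'I_n, s (widen_ord (leqnSn n) i) + e i <= s (lift ord0 i)]].

Let E p := \sum_(i < n | i < p) e i.

Let E0 : E 0 = 0.
Proof. by rewrite /E big_pred0. Qed.

Let ES p (lt_pn : p < n) : E p.+1 = E p + e (Ordinal lt_pn).
Proof.
rewrite /E (bigD1 (Ordinal lt_pn)) //= addnC; congr (_ + _).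
by apply: eq_bigl => i; rewrite -val_eqE /=; lia.
Qed.

Let En : E n = \sum_i e i.
Proof. by rewrite /E; apply: eq_bigl => i; rewrite ltn_ord. Qed.

Let E_le p q : p <= q -> E p <= E q.
Proof.
move=> pq; rewrite /E (big_mkcond (fun i : 'I_n => i < p)).
rewrite (big_mkcond (fun i : 'I_n => i < q)).
by apply: leq_sum => i _; case: ifP => // ip; rewrite (leq_trans ip pq).
Qed.

(** Subtracting the partial sums [E] turns a gapped sequence into a weakly increasing one with
    values at most [k - E n]; without its initial 0 it is a sorted [n]-tuple. The case distinction
    guards against truncated subtraction, which would give a binomial equal to 1 when the gaps
    exceed [k]. *)
Lemma card_gapped k :
  #|gapped k| = if \sum_i e i <= k then 'C(n + (k - \sum_i e i), n) else 0.
Proof.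
rewrite -En; clearbody E.
have gappedP (s : {ffun 'I_n.+1 -> 'I_k.+1}) : s \in gapped k ->
  [/\ s ord0 = ord0,
   forall p, p <= n -> E p <= s (inord p),
   forall p q, p <= q <= n -> E q + s (inord p) <= E p + s (inord q) &
   forall p, s (inord p) <= k].
  rewrite inE => /andP[/eqP s0 /forallP H].
  (* This says that [s - E] is weakly increasing, written additively to avoid truncated
     subtraction. *)
  have mono p q : p <= q <= n -> E q + s (inord p) <= E p + s (inord q).
    elim: q => [|q IH]; first by case: p => // /andP[].
    case/andP; rewrite leq_eqVlt => /orP[/eqP -> //|]; rewrite ltnS => pq qn.
    have /IH : p <= q <= n by rewrite pq ltnW.
    have := H (Ordinal qn); rewrite (ES qn).
    have -> : widen_ord (leqnSn n) (Ordinal qn) = inord q.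
      by apply: val_inj; rewrite /= inordK // ltnW // ltnS.
    have -> : lift ord0 (Ordinal qn) = inord q.+1.
      by apply: val_inj; rewrite /= inordK.
    lia.
  split=> // [p pn|p]; last by rewrite -ltnS; apply: ltn_ord.
  have := mono 0 p; rewrite pn => /(_ isT).
  have -> : inord 0 = ord0 :> 'I_n.+1 by apply: val_inj; rewrite /= inordK.
  by rewrite s0 E0 /=; lia.
case: leqP => [le_Ek|lt_kE]; last first.
  apply/eqP; rewrite cards_eq0; apply/eqP/setP => s; rewrite !inE.
  apply/negP => /= hs; have [|_ /(_ n (leqnn n)) + _ s_le] := gappedP s.
    by rewrite inE.
  by have := s_le n; lia.
rewrite -card_sorted_tuples.
(* The leading 0 restores the fixed value at [ord0] and aligns the index with that of [E]. *)
pose u (t : n.-tuple 'I_(k - E n).+1) := 0 :: map val t.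
have u_le t p : nth 0 (u t) p <= k - E n.
  case: p => [|p] //=; case: (ltnP p n) => pn; last first.
    by rewrite nth_default // size_map size_tuple.
  by rewrite (nth_map ord0) ?size_tuple // -ltnS.
have Eu_le t p : p <= n -> E p + nth 0 (u t) p <= k.
  by move=> /E_le; have := u_le t p; lia.
pose F t : {ffun 'I_n.+1 -> 'I_k.+1} :=
  [ffun x : 'I_n.+1 => inord (E x + nth 0 (u t) x)].
have FE t x : F t x = E x + nth 0 (u t) x :> nat.
  by rewrite ffunE inordK // ltnS Eu_le // -ltnS.
rewrite -(card_in_imset (f := F)); last first.
  move=> t t' _ _ ett'; apply: eq_from_tnth => i.
  have := congr1 (fun f : {ffun 'I_n.+1 -> 'I_k.+1} => val (f (lift ord0 i))) ett'.
  rewrite /= !FE !lift0 => /addnI /=.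
  rewrite !(nth_map ord0) ?size_tuple // => h.
  by apply: val_inj; rewrite /= !(tnth_nth ord0).
apply: eq_card => s; move: s => /= s; apply/idP/imsetP => [hs|[t]].
  have [s0 Es mono s_le] := gappedP s hs.
  have s_n q : q <= n -> s (inord q) - E q <= k - E n.
    move=> qn; have := mono q n; rewrite qn leqnn => /(_ isT).
    by have := s_le n; have := Es q qn; lia.
  pose t := [tuple inord (s (lift ord0 i) - E i.+1) : 'I_(k - E n).+1 | i < n].
  have tE i : val (tnth t i) = s (inord i.+1) - E i.+1.
    rewrite tnth_mktuple.
    have -> : lift ord0 i = inord i.+1 by apply: val_inj; rewrite /= inordK // ltnS.
    by rewrite /= inordK // ltnS s_n.
  have nE p (pn : p < n) : nth 0 (map val t) p = s (inord p.+1) - E p.+1.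
    rewrite -[p]/(val (Ordinal pn)) -(tE (Ordinal pn)) (nth_map ord0) ?size_tuple //.
    by rewrite (tnth_nth ord0).
  exists t.
    rewrite inE; apply/(sortedP 0) => p; rewrite size_map size_tuple => pn.
    rewrite !nE //; last exact: ltnW.
    have := mono p.+1 p.+2; rewrite pn leqnSn => /(_ isT).
    by have := Es p.+2 pn; have := Es p.+1 (ltnW pn); lia.
  apply/ffunP => x; apply: val_inj; rewrite /= FE.
  elim/ord_lift0_ind: x => [|i]; first by rewrite s0 E0.
  have -> : lift ord0 i = inord i.+1 by apply: val_inj; rewrite /= inordK // ltnS.
  rewrite inordK ?ltnS //=; have := nE i (ltn_ord i); rewrite /u /= => ->.
  by rewrite subnKC // Es.
rewrite inE => /(sortedP 0); rewrite size_map size_tuple => tsort ->.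
rewrite inE -val_eqE /= FE E0 /=; apply/forallP => i.
rewrite !FE /= /bump /= add1n (ES (ltn_ord i)).
have -> : Ordinal (ltn_ord i) = i by apply: val_inj.
rewrite addnAC leq_add2l.
case: i => [[|p] hp] //=; exact: tsort.
Qed.

End GappedSequences.

(** * The series with binomial coefficients *)

Section Series.
Local Open Scope ring_scope.

(** A factor [1 - 'X] can be moved to the other side, where it acts as the backward difference
    operator. *)
Lemma series_mul_1subX (p : {poly int}) (u : nat -> int) (i : nat) :
  series_mul (series_of_poly (p * (1 - 'X))) u i =
  series_mul (series_of_poly p)
    (fun k => u k - (if k is k'.+1 then u k' else 0)) i.
Proof.
(* Coefficient [i] of a product only involves coefficients up to [i], so the series may be truncated
   to a polynomial. *)
pose U := \poly_(k < i.+1) u k.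
have Uk k : (k <= i)%N -> U`_k = u k by move=> ki; rewrite coef_poly ltnS ki.
transitivity ((p * (1 - 'X)) * U)`_i.
  rewrite coefM; apply: eq_bigr => j _; rewrite Uk ?leq_subr //.
rewrite -mulrA coefM; apply: eq_bigr => j _; congr (_ * _).
rewrite mulrBl mul1r coefB mulrC coefMX Uk ?leq_subr //.
have := leq_subr j i; case: (i - j)%N => // k ki.
by rewrite /= Uk // ltnW.
Qed.

(** Induction on [n]: by Pascal's rule the backward difference lowers [n] by one. For [n = 0] the
    sequence is the indicator of [l <= k], whose difference is the indicator of [k = l]. *)
Lemma series_mul_binomial (n l i : nat) :
  series_mul (series_of_poly ((1 - 'X) ^+ n.+1))
    (fun k => (if l <= k then 'C(n + (k - l), n) else 0)%N%:Z) i = (i == l)%:R.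
Proof.
have eq_mul p (u v : nat -> int) : u =1 v -> series_mul p u i = series_mul p v i.
  by move=> uv; apply: eq_bigr => j _; rewrite uv.
elim: n => [|n IH].
  rewrite expr1 -[1 - 'X]mul1r series_mul_1subX /series_mul big_ord_recl.
  rewrite big1 => [|j _]; last by rewrite /series_of_poly coefC mul0r.
  rewrite /series_of_poly coefC mul1r subn0 addr0.
  have C0 k : (if (l <= k)%N then 'C(0 + (k - l), 0) else 0%N) = (l <= k)%N.
    by rewrite bin0.
  case: i {eq_mul} => [|k]; rewrite !C0; first by case: (l).
  lia.
rewrite exprSr series_mul_1subX -IH; apply: eq_mul => k.
case: k => [|k]; first by case: l {IH} => //; rewrite !addn0 !binn.
case: (ltnP k l) => kl.
  rewrite subr0; case: leqP => // lk.
  have -> : l = k.+1 by lia.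
  by rewrite subnn !addn0 !binn.
by rewrite (leqW kl) subSn // addSnnS !addnS binS addSn PoszD addrAC subrr add0r.
Qed.

End Series.

(** * Decomposition of the integer points into alcoves *)

Section Decomposition.
Variables (n : nat) (le : rel 'I_n).

(** For distinct elements with equal [r], [x] precedes [y] exactly when the condition in [ldes]
    fails for [(x, y)], once [D] is the descent function. *)
Definition lex_lt (r D : 'I_n.+1 -> nat) : rel 'I_n.+1 := fun x y =>
  (r x < r y) ||
  (r x == r y) && ((D y < D x) || (D x == D y) && (x < y)).

Section LexLt.
Variables r D : 'I_n.+1 -> nat.

Lemma lex_lt_irr : irreflexive (lex_lt r D).
Proof. by move=> x; rewrite /lex_lt !ltnn !eqxx. Qed.

Lemma lex_lt_trans : transitive (lex_lt r D).
Proof. by move=> y x z; rewrite /lex_lt; lia. Qed.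

Lemma lex_lt_total x y : x != y -> lex_lt r D x y || lex_lt r D y x.
Proof. by rewrite -val_eqE /= /lex_lt; lia. Qed.

End LexLt.

Section FixedPermutation.
Variable tau : 'S_n.

Definition ldes : rel 'I_n.+1 := fun x y =>
  (des_at le tau x < des_at le tau y) ||
  (des_at le tau x == des_at le tau y) && (y < x).

Definition gap (i : 'I_n) : nat :=
  ldes ((ext_perm tau)^-1%g (widen_ord (leqnSn n) i))
       ((ext_perm tau)^-1%g (lift ord0 i)).

(** A pair counted by [Ldes] is determined by the lower of its two consecutive values, so such pairs
    are indexed by ['I_n]. *)
Lemma Ldes_sum_gap : Ldes le tau = \sum_i gap i.
Proof.
set S := ext_perm tau.
pose pr (i : 'I_n) := (S^-1%g (widen_ord (leqnSn n) i), S^-1%g (lift ord0 i)).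
rewrite /Ldes -/S.
transitivity #|[set pr i | i in [set i | gap i != 0]]|.
  apply: eq_card => -[x y]; rewrite inE /=; apply/idP/imsetP.
    case/andP=> /eqP xy lxy.
    have Sx : S x < n by have := ltn_ord (S y); rewrite -xy ltnS.
    have wx : widen_ord (leqnSn n) (Ordinal Sx) = S x by apply: val_inj.
    have ly : lift ord0 (Ordinal Sx) = S y by apply: val_inj; rewrite /= /bump /= add1n.
    exists (Ordinal Sx); last by rewrite /pr wx ly !permK.
    by rewrite inE /gap -/S wx ly !permK /ldes lxy.
  case=> i; rewrite inE /gap -/S => gi [-> ->].
  rewrite !permKV /= /bump /= add1n eqxx /=.
  by move: gi; rewrite eqb0 negbK.
rewrite card_imset => [|i j [_ /perm_inj /lift_inj //]].
rewrite -sum1dep_card big_mkcond; apply: eq_bigr => i _.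
by rewrite eqb0 negbK /gap; case: ifP => //= ->.
Qed.

Variable k : nat.
Variable s : {ffun 'I_n.+1 -> 'I_k.+1}.
Hypothesis s_gapped : s \in gapped gap k.

(** The gap conditions make elements with consecutive [tau]-values increase in [lex_lt];
    transitivity extends this to all pairs, and irreflexivity gives the converse. Thus [tau] can be
    read off from [s] and the descent function. *)
Lemma gapped_lex_lt x y : (ext_perm tau x < ext_perm tau y) =
  lex_lt (fun x => s (ext_perm tau x)) (des_at le tau) x y.
Proof.
set S := ext_perm tau; set L := lex_lt _ _.
have homo q u v : S v = q :> nat -> S u < S v -> L u v.
  elim: q v => [|q IH] v vq; first by rewrite vq.
  have qn : q < n by rewrite -ltnS -vq ltn_ord.
  set z := S^-1%g (widen_ord (leqnSn n) (Ordinal qn)).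
  have Sz : S z = q :> nat by rewrite permKV.
  have Sv : S v = lift ord0 (Ordinal qn) by apply: val_inj; rewrite /= /bump /= add1n.
  have zv : L z v.
    (* If [gap] is 1 the value of [s] jumps strictly; if it is 0 then [ldes z v] fails, and a tie in
       [s] is broken in favor of [z]. *)
    move: s_gapped; rewrite inE => /andP[_ /forallP/(_ (Ordinal qn))].
    rewrite /gap -/S -/z -Sv permK -[widen_ord _ _](permKV S) -/z /L /lex_lt /ldes.
    have : z != v by apply: contra_eqN vq => /eqP <-; rewrite Sz; lia.
    by rewrite -val_eqE /=; lia.
  rewrite vq ltnS leq_eqVlt => /orP[/eqP uq|uq].
    suff -> : u = z by [].
    by apply: (@perm_inj _ S); apply: val_inj; rewrite /= uq Sz.
  by apply: (@lex_lt_trans _ _ z) => //; apply: IH; rewrite ?Sz.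
apply/idP/idP => [/(homo _ _ _ erefl) //|xy]; rewrite ltnNge; apply/negP => yx.
have : L y x.
  apply: (homo _ _ _ erefl); rewrite ltn_neqAle yx andbT.
  apply: contraTneq xy => /ord_inj/perm_inj ->; by rewrite /L lex_lt_irr.
by move=> /(lex_lt_trans xy); rewrite lex_lt_irr.
Qed.

Definition alcove_point (x : 'I_n.+1) : nat :=
  k * des_at le tau x + s (ext_perm tau x).

End FixedPermutation.

Hypothesis le_poset : is_poset le.
Hypothesis le_natural : naturally_labeled le.

(* [g] extends by 0 at the new minimum an integer point of the k-th dilate of
   the Lipschitz polytope; such points are nonnegative. *)
Definition dilate_fun k (g : 'I_n.+1 -> nat) : Prop :=
  g ord0 = 0 /\
  forall x y, covers (check_le le) x y -> g x <= g y <= g x + k.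

Lemma dilate_fun0 g : dilate_fun 0 g -> forall x, g x = 0.
Proof.
case=> g0 gc x; elim/(cover_ind le_poset le_natural): x => // x y /gc; lia.
Qed.

(** A positive remainder lies between 1 and [k], so taking the predecessor before dividing recovers
    the quotient. At remainder 0, [x] ties with [ord0], which comes first; larger descent numbers go
    first on ties, so that of [x] is 0. *)
Lemma des_at_alcove_point tau k s x : s \in gapped (gap tau) k ->
  des_at le tau x = (alcove_point tau s x).-1 %/ k.
Proof.
move=> hs; rewrite /alcove_point.
case E : (val (s (ext_perm tau x))) => [|m]; rewrite /= in E; last first.
  have km : m < k by rewrite -ltnS -E ltn_ord.
  by rewrite addnS /= mulnC divnMDl ?divn_small ?addn0 //; lia.
suff -> : des_at le tau x = 0 by rewrite muln0 div0n.
elim/ord_lift0_ind: x E => [|i] E; first by rewrite des_at0.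
have := gapped_lex_lt hs ord0 (lift ord0 i).
rewrite ext_perm0 {1}ext_perm_lift /lex_lt E des_at0 /=.
by case/esym/and3P => _ /eqP.
Qed.

(** The point determines in turn the descent function, the remainders, their sorting order [tau],
    and finally [s]. *)
Lemma alcove_point_inj k tau1 tau2 (s1 s2 : {ffun 'I_n.+1 -> 'I_k.+1}) :
    s1 \in gapped (gap tau1) k -> s2 \in gapped (gap tau2) k ->
    alcove_point tau1 s1 =1 alcove_point tau2 s2 ->
  (tau1, s1) = (tau2, s2).
Proof.
move=> h1 h2 eqp.
have eqD x : des_at le tau1 x = des_at le tau2 x.
  by rewrite (des_at_alcove_point x h1) (des_at_alcove_point x h2) eqp.
have eqr x : s1 (ext_perm tau1 x) = s2 (ext_perm tau2 x).
  by apply: val_inj; have := eqp x; rewrite /alcove_point eqD => /addnI.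
have eqt : tau1 = tau2.
  apply: ext_perm_order_inj => x y; rewrite (gapped_lex_lt h1) (gapped_lex_lt h2).
  by rewrite /lex_lt !eqr !eqD.
move: eqr; rewrite -eqt => eqr; congr (_, _); apply/ffunP => p.
by rewrite -[p](permKV (ext_perm tau1)) eqr.
Qed.

(** At an ascent of [tau] the remainder does not decrease and the descent number is unchanged; at a
    descent the remainder does not increase and the descent number grows by 1. In both cases the
    value grows by an amount between 0 and [k]. *)
Lemma dilate_fun_alcove_point k tau (s : {ffun 'I_n.+1 -> 'I_k.+1}) :
  tau \in DC le -> s \in gapped (gap tau) k -> dilate_fun k (alcove_point tau s).
Proof.
move=> dc hs; split.
  rewrite /alcove_point des_at0 ext_perm0 muln0.
  by move: hs; rewrite inE => /andP[/eqP -> _].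
move=> x y xy; rewrite /alcove_point (des_at_cover le_poset le_natural dc xy).
have := ltn_ord (s (ext_perm tau x)); have := ltn_ord (s (ext_perm tau y)).
have nxy : x != y by case/and3P: xy.
have := lex_lt_total (fun x => s (ext_perm tau x)) (des_at le tau) nxy.
rewrite -!(gapped_lex_lt hs).
case: (ltnP (ext_perm tau y) (ext_perm tau x)) => [yx _|xy' /=].
  have := gapped_lex_lt hs y x; rewrite yx /lex_lt; lia.
rewrite orbF => xy''.
have := gapped_lex_lt hs x y; rewrite xy'' /lex_lt; lia.
Qed.

(* The point [g] is moved slightly towards a generic point of the alcove of the
   identity; the integer parts after this move are [D], and sorting the
   fractional parts is sorting by [lex_lt r D]. *)
Lemma alcove_point_surj k g : dilate_fun k g ->
  exists tau (s : {ffun 'I_n.+1 -> 'I_k.+1}),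
    [/\ tau \in DC le, s \in gapped (gap tau) k & alcove_point tau s =1 g].
Proof.
move=> gk; have [g0 gc] := gk.
(* The predecessor gives a positive multiple of [k] the remainder [k] instead of 0. *)
pose D x := (g x).-1 %/ k; pose r x := g x - k * D x.
have gE x : g x = k * D x + r x.
  by rewrite /r subnKC // mulnC (leq_trans (leq_divM _ _)) ?leq_pred.
have rk x : r x <= k.
  case: (posnP k) => [k0|k_gt0].
    by rewrite /r; move: gk; rewrite k0 => /dilate_fun0 ->.
  have := divn_eq (g x).-1 k; rewrite -/(D x); have := ltn_pmod (g x).-1 k_gt0.
  by rewrite /r mulnC; lia.
have r0 x : r x = 0 -> D x = 0.
  case: (posnP k) => [k0|k_gt0]; first by rewrite /D k0.
  have := divn_eq (g x).-1 k; rewrite -/(D x); have := gE x.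
  case: (g x) => [|m] /=; rewrite mulnC; first by case: (D x) => // d; nia.
  lia.
have D0 : D ord0 = 0 by rewrite /D g0 div0n.
have R0 : r ord0 = 0 by rewrite /r g0.
have Dc x y : covers (check_le le) x y -> D x <= D y <= (D x).+1.
  move/gc => /andP[xy yx]; rewrite leq_div2r ?leq_pred2 /=; last by lia.
  case: (posnP k) => [k0|k_gt0]; first by rewrite /D k0.
  (* The value 0 is treated apart because its predecessor is truncated; there [g y <= k] gives
     [D y = 0] directly. *)
  case: (posnP (g x)) => [gx0|gx_gt0].
    by rewrite /D divn_small //; move: yx; rewrite gx0; lia.
  have -> : (D x).+1 = ((g x).-1 + k) %/ k.
    by rewrite divnDr ?dvdnn // divnn k_gt0 addn1.
  by apply: leq_div2r; lia.
have [||||tau tauE] := @exists_ext_perm n (lex_lt r D).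
- exact: lex_lt_irr.
- exact: lex_lt_trans.
- exact: lex_lt_total.
- move=> i; rewrite /lex_lt R0 D0.
  by case: (posnP (r (lift ord0 i))) => [ri|//]; rewrite (r0 _ ri) ri.
have [dc desE] : tau \in DC le /\ des_at le tau =1 D.
  apply: (descent_potential le_poset le_natural D0) => x y xy.
  rewrite tauE; have := Dc _ _ xy; have := gc _ _ xy.
  have := check_covers_lt le_natural xy.
  rewrite /lex_lt (gE x) (gE y) => lt_xy /andP[g1 g2] /andP[D1 D2].
  (* If [D] is constant, then [r x <= r y] and a tie goes to the smaller label [x]: an ascent. If
     [D] grows, then [r y <= r x] and a tie goes to the larger [D], at [y]: a descent. *)
  have [DE|DE] : D y = D x \/ D y = (D x).+1 by lia.
    by move: g1 g2; rewrite DE; lia.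
  by move: g1 g2; rewrite DE mulnS; lia.
set S := ext_perm tau.
pose s : {ffun 'I_n.+1 -> 'I_k.+1} := [ffun p => inord (r (S^-1%g p))].
have sE p : s p = r (S^-1%g p) :> nat by rewrite ffunE inordK // ltnS.
exists tau, s; split=> // [|x]; last by rewrite /alcove_point sE permK desE -gE.
rewrite inE; apply/andP; split.
  by rewrite -val_eqE /= sE -{1}(ext_perm0 tau) permK R0.
apply/forallP => i; rewrite !sE /gap -/S.
(* The elements [z] and [y] are consecutive for [tau], so a tie of their remainders rules out
   [ldes z y]. *)
set z := S^-1%g _; set y := S^-1%g (lift _ _).
have : lex_lt r D z y by rewrite -tauE -/S !permKV /= /bump /= add1n.
by rewrite /lex_lt /ldes !desE; lia.
Qed.

End Decomposition.

(** * Integer points of the dilated Lipschitz polytope *)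

Lemma card_fset_set_imset (T : finType) (U : choiceType) (f : T -> U)
    (A : {set T}) (B : set U) :
    {in A &, injective f} -> (forall u, B u <-> exists2 x, x \in A & u = f x) ->
  #|` fset_set B| = #|A|.
Proof.
move=> finj BE.
have -> : B = [set` seq_fset tt [seq f x | x <- enum A]]%classic.
  apply/seteqP; split => u; rewrite /mkset seq_fsetE.
    by case/BE => x xA ->; apply: map_f; rewrite mem_enum.
  by case/mapP => x; rewrite mem_enum => xA ->; apply/BE; exists x.
rewrite set_fsetK size_seq_fset undup_id ?size_map -?cardE //.
rewrite map_inj_in_uniq ?enum_uniq // => x y; rewrite !mem_enum; exact: finj.
Qed.

Section LatticePoints.
Local Open Scope ring_scope.
Variables (R : realType) (n : nat) (le : rel 'I_n).

Definition ext_row (f : 'rV[R]_n) (x : 'I_n.+1) : R :=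
  if unlift ord0 x is Some i then f 0 i else 0.

Lemma ext_row0 f : ext_row f ord0 = 0.
Proof. by rewrite /ext_row unlift_none. Qed.

Lemma ext_row_lift f i : ext_row f (lift ord0 i) = f 0 i.
Proof. by rewrite /ext_row liftK. Qed.

(** The bounds at minimal elements are the cover inequalities above the adjoined minimum, where the
    function is 0. *)
Lemma lipschitz_polytopeP f : lipschitz_polytope R le f <->
  forall x y, covers (check_le le) x y -> 0 <= ext_row f y - ext_row f x <= 1.
Proof.
split=> [[fmin fcov] x y|fE].
  elim/ord_lift0_ind: y => [|b]; first by rewrite check_covers_x0.
  elim/ord_lift0_ind: x => [|a].
    by rewrite check_covers_0lift ext_row0 ext_row_lift subr0 => /fmin.
  by rewrite check_covers_lift !ext_row_lift => /fcov.
split=> [a|a b ab].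
  by rewrite -check_covers_0lift => /fE; rewrite ext_row0 ext_row_lift subr0.
by rewrite -!ext_row_lift; apply: fE; rewrite check_covers_lift.
Qed.

Hypothesis le_poset : is_poset le.
Hypothesis le_natural : naturally_labeled le.

Lemma dilate_lipschitzP k (f : 'rV[R]_n) :
  (dilate k (lipschitz_polytope R le) `&` @lattice R n)%classic f <->
  exists2 g, dilate_fun le k g & f = \row_i (g (lift ord0 i))%:R.
Proof.
split.
  case=> -[h /lipschitz_polytopeP hL <-] hint.
  set F := ext_row (k%:R *: h).
  have FE x : F x = k%:R * ext_row h x.
    elim/ord_lift0_ind: x => [|i]; rewrite /F ?ext_row0 ?mulr0 //.
    by rewrite !ext_row_lift mxE.
  have Fc x y : covers (check_le le) x y -> F x <= F y <= F x + k%:R.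
    move/hL; rewrite !FE => /andP[h0 h1]; apply/andP; split.
      by apply: ler_wpM2l; rewrite ?ler0n // -subr_ge0.
    by rewrite -lerBlDl -mulrBr ler_piMr ?ler0n.
  (* Values are integers by assumption, and nonnegative by induction along covers starting from
     0. *)
  have Fnat x : F x \is a Num.nat.
    rewrite natrEint; apply/andP; split.
      by elim/ord_lift0_ind: x => [|i]; rewrite /F ?ext_row0 ?rpred0 // ext_row_lift.
    elim/(cover_ind le_poset le_natural): x => [|x y /Fc/andP[xy _] x0].
      by rewrite /F ext_row0.
    exact: le_trans x0 xy.
  exists (fun x => Num.trunc (F x)).
    split=> [|x y /Fc]; first by rewrite /F ext_row0 truncn0.
    by rewrite -(truncnK (Fnat x)) -(truncnK (Fnat y)) -natrD !ler_nat !natrK.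
  by apply/rowP => i; rewrite [RHS]mxE truncnK // /F ext_row_lift.
case=> g gk ->; split; last by move=> i; rewrite mxE natr_int.
case: (posnP k) => [k0|k_gt0].
  exists 0.
    apply/lipschitz_polytopeP => x y _.
    have e0 z : ext_row 0 z = 0 by rewrite /ext_row; case: unlift => // i; rewrite mxE.
    by rewrite !e0 subrr lexx ler01.
  move: gk; rewrite k0 => /(dilate_fun0 le_poset le_natural) g0.
  by rewrite scaler0; apply/rowP => i; rewrite !mxE g0.
have k0 : (k%:R : R) != 0 by rewrite pnatr_eq0 -lt0n.
exists (\row_i ((g (lift ord0 i))%:R / k%:R)); last first.
  by apply/rowP => i; rewrite !mxE mulrCA divff ?mulr1.
apply/lipschitz_polytopeP => x y.
have eE z : ext_row (\row_i ((g (lift ord0 i))%:R / k%:R)) z = (g z)%:R / k%:R.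
  elim/ord_lift0_ind: z => [|i]; last by rewrite ext_row_lift mxE.
  by rewrite ext_row0 gk.1 mul0r.
move/(gk.2) => /andP[xy yx]; rewrite !eE -mulrBl.
rewrite ler_pdivrMr ?ltr0n // mul1r lerBlDl -natrD ler_nat yx andbT.
by rewrite mulr_ge0 ?invr_ge0 ?ler0n // subr_ge0 ler_nat.
Qed.

Lemma lattice_count_lipschitz k :
  lattice_count (lipschitz_polytope R le) k =
  (\sum_(tau in DC le) #|gapped (gap le tau) k|)%N.
Proof.
pose A := [set p : 'S_n * {ffun 'I_n.+1 -> 'I_k.+1} |
  (p.1 \in DC le) && (p.2 \in gapped (gap le p.1) k)].
pose f (p : 'S_n * {ffun 'I_n.+1 -> 'I_k.+1}) : 'rV[R]_n :=
  \row_i (alcove_point le p.1 p.2 (lift ord0 i))%:R.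
transitivity #|A|.
  apply: (@card_fset_set_imset _ _ f).
    move=> [t1 s1] [t2 s2]; rewrite inE => /andP[dc1 h1].
    rewrite inE => /andP[dc2 h2] ef.
    apply: (alcove_point_inj h1 h2) => x.
    have [p1 _] := dilate_fun_alcove_point le_poset le_natural dc1 h1.
    have [p2 _] := dilate_fun_alcove_point le_poset le_natural dc2 h2.
    elim/ord_lift0_ind: x => [|i]; first by rewrite p1 p2.
    by have /rowP/(_ i) := ef; rewrite !mxE => /eqP; rewrite eqr_nat => /eqP.
  move=> u; apply: (iff_trans (dilate_lipschitzP k u)); split.
    case=> g /(alcove_point_surj le_poset le_natural) [t [s [dc hs gE]]] ->.
    exists (t, s); first by rewrite inE /= dc.
    by apply/rowP => i; rewrite !mxE gE.
  case=> -[t s]; rewrite inE /= => /andP[dc hs] ->.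
  by exists (alcove_point le t s) => //; apply: dilate_fun_alcove_point.
rewrite -sum1_card (eq_bigr (fun tau => \sum_(s in gapped (gap le tau) k) 1)%N).
  by rewrite pair_big_dep; apply: eq_bigl => p; rewrite inE.
by move=> tau _; rewrite sum1_card.
Qed.

End LatticePoints.

Theorem theorem3p7 (R : realType) (n : nat) (le : rel 'I_n)
    (le_poset : is_poset le) (le_natural : naturally_labeled le)
    (le_connected : connected_poset le) :
  hstar (lipschitz_polytope R le) =1 series_of_poly (G_Ldes le).
Proof.
move=> i; rewrite /series_of_poly /G_Ldes coef_sum.
transitivity (\sum_(tau in DC le) (i == Ldes le tau)%:R : int)%R; last first.
  by apply: eq_bigr => tau _; rewrite coefXn.
(* Each monomial is expanded as [(1 - 'X) ^+ n.+1] times a binomial series. After exchanging the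
   sums, it remains to compare the lattice count with the sum of the binomials over [tau]. *)
rewrite -(eq_bigr _ (fun tau _ => series_mul_binomial n (Ldes le tau) i)).
rewrite exchange_big; apply: eq_bigr => j _; rewrite -mulr_sumr; congr (_ * _)%R.
rewrite lattice_count_lipschitz // -natz natr_sum; apply: eq_bigr => tau _.
by rewrite card_gapped -Ldes_sum_gap natz.
Qed.
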